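(* Let $F$ be the cumulative distribution function of a probability distribution on $[0,1]$, let $(c_n)_{n\ge 0}$ be i.i.d. random variables with cumulative distribution function $F$ (write $c$ for a generic one), with mean $\mu$ and variance $\sigma^2$, and let $r_0$ be an absolutely continuous random variable with values in $[0,1]$, independent of $(c_n)_{n\ge0}$. Define $r_{n+1}=T(c_n,r_n)$ for $n\ge 0$, with $T$ as given in the context, and let $g_n$ be the probability density function of $r_n$. If $\mathbb{P}[0<c<1]>0$, then $$\|g_n-1\|_{L^1}\longrightarrow 0\qquad (n\to\infty).$$ Moreover, for every $\varepsilon>0$ one has $\|g_n-1\|_{L^1}\le\varepsilon+O(\mu_\ell^n)$, i.e., there is a constant $C_\varepsilon$ (independent of $n$) such that $\|g_n-1\|_{L^1}\le\varepsilon+C_\varepsilon\,\mu_\ell^n$ for all $n\ge 0$, where $\mu_\ell=1-2(\mu-\mu^2-\sigma^2)$.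
   Context: For $c,r\in[0,1]$ the rescaling map is $$T(c,r)=\begin{cases}\dfrac{r}{c} & \text{if } c\ge r,\\[2mm] \dfrac{r-c}{1-c} & \text{if } c<r,\end{cases}$$ with the convention $T(0,0)=0$. ''Absolutely continuous'' means that the random variable admits a probability density function on $[0,1]$. If $r_0$ is absolutely continuous then so is every $r_n$, so $g_n$ is well defined; the densities satisfy $$g_{n+1}(u)=\int_0^1\bigl(c\,g_n(cu)+(1-c)\,g_n(c+(1-c)u)\bigr)\,\mathrm{d}F(c).$$ $\|\cdot\|_{L^1}$ is the norm of $L^1([0,1])$ with respect to Lebesgue measure. *)

(* Defs.v *)
From HB Require Import structures.
From mathcomp Require Export all_boot all_order all_algebra.
From mathcomp Require Import finmap.
From mathcomp Require Export all_classical all_reals all_analysis.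

Set Implicit Arguments.
Unset Strict Implicit.
Unset Printing Implicit Defensive.

Import Order.TTheory GRing.Theory Num.Theory.
Import numFieldNormedType.Exports.

Local Open Scope classical_set_scope.
Local Open Scope ring_scope.

(* Meaningful for c, r in [0, 1] only.  The value T(0, 0) = 0 comes from the
   totalized division x / 0 = 0; the second branch never divides by 0 on
   [0, 1], since c < r <= 1 there. *)
Definition rescale (R : realType) (c r : R) : R :=
  if r <= c then r / c else (r - c) / (1 - c).

Definition cdf_on_unit (R : realType) (F : R -> R) : Prop :=
  exists2 nu : probability (measurableTypeR R) R,
    nu `[0, 1]%classic = 1%E & forall x, nu `]-oo, x]%classic = (F x)%:E.

Section independence.
Context d (Omega : measurableType d) (R : realType) (P : probability Omega R).

Definition mutually_independent (I : choiceType) (X : I -> {RV P >-> R}) : Prop :=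
  forall (J : {fset I}) (A : I -> set R), (forall i, measurable (A i)) ->
    P (\bigcap_(i in [set` J]) (X i @^-1` A i)) =
    (\prod_(i <- J) P (X i @^-1` A i))%E.

Definition sigma_algebra_of_family (I : Type) (X : I -> {RV P >-> R}) :
    set (set Omega) :=
  <<s \bigcup_i preimage_set_system setT (X i) measurable >>.

Definition independent_of_family (I : Type) (Y : {RV P >-> R})
    (X : I -> {RV P >-> R}) : Prop :=
  forall (A : set R) (E : set Omega), measurable A ->
    sigma_algebra_of_family X E ->
    P (Y @^-1` A `&` E) = (P (Y @^-1` A) * P E)%E.

(* The density lives on [0, 1]: values of g outside [0, 1] are irrelevant, and
   taking A = setT gives X \in [0, 1] almost surely. *)
Definition is_pdf (X : {RV P >-> R}) (g : R -> R) : Prop :=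
  [/\ measurable_fun (`[0, 1]%classic : set R) g,
      forall u, u \in `[0, 1] -> 0 <= g u &
      forall A : set R, measurable A ->
        distribution P X A =
        (\int[lebesgue_measure]_(u in A `&` `[0%R, 1%R]) (g u)%:E)%E].

Definition absolutely_continuous_rv (X : {RV P >-> R}) : Prop :=
  exists g, is_pdf X g.

End independence.

Definition L1norm (R : realType) (f : R -> R) : \bar R :=
  (\int[lebesgue_measure]_(u in `[0%R, 1%R]) `|f u|%:E)%E.

(* Main.v *)
Require Import Defs.
From mathcomp Require Import all_boot all_order all_algebra finmap.
From mathcomp Require Import all_classical all_reals all_analysis.
From mathcomp Require Import measurable_realfun ring lra.

Set Implicit Arguments.
Unset Strict Implicit.
Unset Printing Implicit Defensive.

Import Order.TTheory GRing.Theory Num.Theory.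
Import numFieldNormedType.Exports.

Local Open Scope classical_set_scope.
Local Open Scope ring_scope.

(** For a fixed [c] in [0, 1] the map [rescale c] consists of two affine
    branches, [0, c] and ]c, 1], each of which is stretched onto [0, 1].  It
    therefore sends the measure of density [h] on [0, 1] to the measure of
    density [u |-> c h(cu) + (1 - c) h(c + (1 - c)u)] ([split_average],
    [integral_rescale_preimage]).  Averaging over the law of [c] gives the
    operator [transfer] that carries the density of [r_n] to that of [r_(n+1)].

    Two properties of this operator give the theorem.  First, it is an average
    of push-forwards, so that it does not increase distances between measures,
    and it fixes the constant 1.  Second, the chain rule brings out one more
    factor [c] or [1 - c], so that it multiplies Lipschitz constants by the mean
    of [c ^ 2 + (1 - c) ^ 2] ([next_density_lipschitz]).  That mean equals
    [1 - 2 (mu - mu ^ 2 - sigma ^ 2)] ([split_second_moment]) and is smaller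
    than 1 because [c (1 - c)] is positive with positive probability.

    Hence a Lipschitz density of total mass 1 tends uniformly to 1 at a
    geometric rate.  A general density [g_0] is first replaced by a bounded
    nonnegative Lipschitz function [h] at L1 distance [eps / 3]
    ([lipschitz_approximation]); the distance between [g_n] and the iterates of
    [h] never grows, the iterates of [h] become nearly constant, and their mean
    is 1 up to [eps / 3] ([L1norm_pdf_sub1]).  The constant in front of the
    geometric term is the Lipschitz constant of [h], which depends on [eps] but not
    on [n].

    The distance between the law of [r_n] and the measure of density [h] is
    measured set by set, through the masses of Borel sets ([close_to]).  In that
    form it passes through the average over [c] at once ([close_to_step]), and
    it compares a law with a function whose total mass need not be 1.  It
    controls the L1 distance with a factor 2 ([L1_of_close_to]).

    The probabilistic input is that [c_n] and [r_n] are independent, so that the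
    law of [r_(n+1)] is the average over [c] of the images of the law of [r_n]
    ([chain_step]).  As [r_n] is a function of [r_0, c_0, ..., c_(n-1)] given
    only by recursion, what is proved by induction is the independence of [r_n]
    from all of [c_n, c_(n+1), ...] ([present_future_indep]). *)

(** * Affine changes of variables *)

Section affine_change_of_variables.
Context (R : realType).
Notation lam := (@lebesgue_measure R).
Implicit Types (a b : R).

Lemma measurable_affine a b : measurable_fun setT (fun u : R => a * u + b).
Proof.
by apply: measurable_funD => //; apply: measurable_funM.
Qed.

Lemma preimage_affine_itv a b x y : 0 < a ->
  (fun u => a * u + b) @^-1` `]x, y] = `](x - b) / a, (y - b) / a]%classic.
Proof.
move=> a0; apply/seteqP; split => u /=;
  by rewrite !in_itv/= ltr_pdivrMr// ler_pdivlMr// ltrBlDr lerBrDr [u * a]mulrC.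
Qed.

(** A measure that agrees with Lebesgue measure on the intervals ]x, y] is
    Lebesgue measure.  The scaling is put inside the push-forward, which is the
    form needed to change variables in integrals. *)
Lemma lebesgue_measure_affine a b (B : set R) (a0 : 0 < a) : measurable B ->
  lam B = pushforward (mscale (NngNum (ltW a0)) lam)
    ((fun u => a * u + b) : _ -> measurableTypeR R) B.
Proof.
move=> mB; apply: lebesgue_measure_unique => //=.
  by apply: measurable_affine.
move=> mf X [[x y] _ <-].
rewrite /= /pushforward /mscale /= preimage_affine_itv//.
rewrite !lebesgue_measure_itv/= !lte_fin.
rewrite ltr_pM2r ?invr_gt0// ltrD2r.
case: ifPn => _; last by rewrite mule0.
by rewrite -!EFinB -EFinM; congr EFin; field; exact: lt0r_neq0.
Qed.

Lemma ge0_integral_affine a b (B : set R) (f : R -> \bar R) :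
  0 < a -> measurable B -> measurable_fun B f -> (forall x, 0 <= f x)%E ->
  (\int[lam]_(x in B) f x =
   a%:E * \int[lam]_(u in (fun u => a * u + b)%R @^-1` B) f (a * u + b)%R)%E.
Proof.
move=> a0 mB mf f0.
have mphi : measurable_fun setT
    ((fun u => a * u + b) : measurableTypeR R -> measurableTypeR R).
  exact: measurable_affine.
have mB' : measurable ((fun u : R => a * u + b) @^-1` B).
  by rewrite -[X in measurable X]setTI; exact: mphi.
have mfphi : measurable_fun ((fun u : R => a * u + b) @^-1` B)
    (f \o (fun u : R => a * u + b)).
  by apply: (measurable_comp mB) => //; [move=> _ [u Bu <-]|
    exact: measurable_funTS].
transitivity (\int[mscale (NngNum (ltW a0)) lam]_(u in
    (fun u => a * u + b)%R @^-1` B) (f \o (fun u => a * u + b)%R) u)%E; last first.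
  by rewrite ge0_integral_mscale// => x _; exact: f0.
rewrite -(@ge0_integral_pushforward _ _ _ _ R _ mphi)//.
apply: eq_measure_integral => A mA AB /=.
exact: lebesgue_measure_affine.
Qed.

End affine_change_of_variables.

(** * The image of a density under the rescaling map *)

Section rescale.
Context (R : realType).
Implicit Types (c r u : R) (A : set R) (h : R -> R).
Notation lam := (@lebesgue_measure R).
Notation I01 := (`[0%R, 1%R]%classic : set R).

(** Inversion is continuous away from 0; at 0, where x^-1 = 0 by convention, the
    case distinction takes over. *)
Lemma measurable_invr : measurable_fun [set: R] (fun x : R => x^-1).
Proof.
have -> : (fun x : R => x^-1) = (fun x => if x == 0 then 0 else x^-1).
  by apply/funext => x; case: eqP => [->|//]; rewrite invr0.
have mT : measurable [set x : R | x == 0].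
  by rewrite (_ : [set _ | _] = [set 0])//; apply/seteqP; split => x /eqP.
have m0 : measurable_fun setT (fun x : R => x == 0).
  by apply: measurable_fun_eqr => //.
apply: measurable_fun_if => //.
rewrite setTI; apply: open_continuous_measurable_fun.
  rewrite (_ : _ @^-1` _ = [set x | x != 0]); first exact: open_neq.
  by apply/seteqP; split => x /=; case: (x == 0).
by move=> x /=; rewrite inE/= => /eqP/eqP x0; exact: inv_continuous.
Qed.

Lemma measurable_rescale :
  measurable_fun setT (fun p : R * R => rescale p.1 p.2).
Proof.
apply: measurable_fun_ifT.
- by apply: measurable_fun_ler.
- apply: measurable_funM => //.
  exact: (measurableT_comp measurable_invr).
- apply: measurable_funM; first exact: measurable_funB.
  by apply: (measurableT_comp measurable_invr); exact: measurable_funB.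
Qed.

Lemma measurable_rescale_preimage c A :
  measurable A -> measurable (rescale c @^-1` A).
Proof.
move=> mA; rewrite -[X in measurable X]setTI.
have mf : measurable_fun setT
    ((fun p : R * R => rescale p.1 p.2) \o (fun r => (c, r))).
  apply: (measurableT_comp measurable_rescale).
  exact: measurable_pair1.
exact: mf.
Qed.

Lemma rescale_left c u : 0 < c -> u <= 1 -> rescale c (c * u) = u.
Proof.
move=> c0 u1; rewrite /rescale ger_pMr// u1 mulrC mulKf//.
exact: lt0r_neq0.
Qed.

Lemma rescale_right c u : c < 1 -> 0 < u -> rescale c ((1 - c) * u + c) = u.
Proof.
move=> c1 u0; rewrite /rescale gerDr leNgt mulr_gt0 ?subr_gt0//=.
by rewrite addrK mulrC mulKf// lt0r_neq0// subr_gt0.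
Qed.

Lemma rescale1 r : r <= 1 -> rescale 1 r = r.
Proof. by move=> r1; rewrite /rescale r1 divr1. Qed.

Lemma rescale0 r : 0 <= r -> rescale 0 r = r.
Proof.
rewrite /rescale !subr0 divr1; case: ifPn => // r_le0 r_ge0.
by rewrite (@le_anti _ _ r 0) ?mul0r// r_le0 r_ge0.
Qed.

Definition split_average h c u := c * h (c * u) + (1 - c) * h (c + (1 - c) * u).

Lemma measurable_split_average h : measurable_fun setT h ->
  measurable_fun setT (fun p : R * R => split_average h p.1 p.2).
Proof.
move=> mh; apply: measurable_funD; apply: measurable_funM => //.
- by apply: measurableT_comp => //; exact: measurable_funM.
- by apply: measurable_funB.
- apply: measurableT_comp => //; apply: measurable_funD => //.
  by apply: measurable_funM => //; exact: measurable_funB.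
Qed.

Lemma split_average_ge0 h c u : (forall x, 0 <= h x) -> 0 <= c <= 1 ->
  0 <= split_average h c u.
Proof.
by move=> h0 /andP[c0 c1]; rewrite addr_ge0// mulr_ge0// subr_ge0.
Qed.

(** The preimage of [A] splits along [0, c] and ]c, 1]; on each piece
    [rescale c] is inverse to an affine map of slope [c], respectively [1 - c].
    For [c = 0] and [c = 1] the map is the identity of [0, 1]. *)
Lemma integral_rescale_preimage h c A :
  measurable_fun setT h -> (forall x, 0 <= h x) -> 0 <= c <= 1 ->
  measurable A ->
  (\int[lam]_(r in rescale c @^-1` A `&` I01) (h r)%:E =
   \int[lam]_(u in A `&` I01) (split_average h c u)%:E)%E.
Proof.
move=> mh h0 c01 mA; have /andP[c0 c1] := c01.
have mI : measurable (A `&` I01) by exact: measurableI.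
have mhE (D : set R) : measurable_fun D (EFin \o h).
  by apply/measurable_EFinP; exact: measurable_funTS.
have mp := measurable_rescale_preimage c mA.
move: c1; rewrite le_eqVlt => /predU1P[c1|c1].
  rewrite c1; rewrite (_ : rescale 1 @^-1` A `&` I01 = A `&` I01).
    by apply: eq_integral => u _; rewrite /split_average subrr mul0r addr0 !mul1r.
  apply/seteqP; split => u [] /= uA; rewrite in_itv/= => /andP[u0 u1];
    by split; rewrite ?in_itv/= ?u0//; move: uA; rewrite /= rescale1.
move: c0; rewrite le_eqVlt => /predU1P[c0|c0].
  rewrite -c0; rewrite (_ : rescale 0 @^-1` A `&` I01 = A `&` I01).
    apply: eq_integral => u _.
    by rewrite /split_average !mul0r subr0 !add0r !mul1r.
  apply/seteqP; split => u [] /= uA; rewrite in_itv/= => /andP[u0 u1];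
    by split; rewrite ?in_itv/= ?u0//; move: uA; rewrite /= rescale0.
have c'0 : 0 < 1 - c by rewrite subr_gt0.
have left_part : (\int[lam]_(x in rescale c @^-1` A `&` `[0%R, c]) (h x)%:E =
    c%:E * \int[lam]_(u in A `&` I01) (h (c * u)%R)%:E)%E.
  have mB : measurable (rescale c @^-1` A `&` `[0, c]%classic) by exact: measurableI.
  rewrite (@ge0_integral_affine _ c 0 _ (EFin \o h) c0 mB (mhE _))//.
  have -> : (fun u => c * u + 0) @^-1` (rescale c @^-1` A `&` `[0, c]) =
      A `&` I01.
    apply/seteqP; split => u /=; rewrite !in_itv/= addr0 pmulr_rge0// ger_pMr//.
      by move=> [+ /andP[u0 u1]]; rewrite rescale_left// u0 u1.
    by move=> [+ /andP[u0 u1]]; rewrite rescale_left// u0 u1.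
  by under eq_integral do rewrite /= addr0.
have right_part : (\int[lam]_(x in rescale c @^-1` A `&` `]c, 1%R]) (h x)%:E =
    (1 - c)%:E * \int[lam]_(u in A `&` I01) (h (c + (1 - c) * u)%R)%:E)%E.
  have mB : measurable (rescale c @^-1` A `&` `]c, 1]%classic) by exact: measurableI.
  rewrite (@ge0_integral_affine _ (1 - c) c _ (EFin \o h) c'0 mB (mhE _))//.
  have -> : (fun u => (1 - c) * u + c) @^-1` (rescale c @^-1` A `&` `]c, 1]) =
      (A `&` I01) `\ 0.
    apply/seteqP; split => u /=; rewrite !in_itv/= ltrDr pmulr_rgt0//
      -lerBrDr ger_pMr//.
      move=> [+ /andP[u0 u1]]; rewrite rescale_right// (ltW u0) u1; split => //.
      by apply/eqP; rewrite gt_eqF.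
    move=> [[+ /andP[u0 u1]] /eqP un0].
    have {u0}u0 : 0 < u by rewrite lt_neqAle eq_sym un0.
    by rewrite rescale_right// u0 u1.
  rewrite integral_setD1//; [|exact: measurableD|]; last first.
    apply/measurable_EFinP/measurable_funTS.
    exact: (measurableT_comp mh (measurable_affine (1 - c) c)).
  by under eq_integral do rewrite /= addrC.
have -> : rescale c @^-1` A `&` I01 =
    (rescale c @^-1` A `&` `[0, c]) `|` (rescale c @^-1` A `&` `]c, 1]).
  rewrite -setIUr; congr (_ `&` _); apply/seteqP; split => u /=;
    rewrite !in_itv/=; last first.
    move=> [/andP[-> uc]|/andP[/ltW cu ->]].
      by rewrite (le_trans uc) ?ltW.
    by rewrite (le_trans (ltW c0) cu).
  by move=> /andP[-> ->]; rewrite andbT/=; case: leP; [left|right].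
have dj : [disjoint rescale c @^-1` A `&` `[0, c] &
    rescale c @^-1` A `&` `]c, 1]].
  apply/disj_setPRL => u [_ /=]; rewrite !in_itv/= => /andP[cu _] [_].
  by rewrite [u <= c]leNgt cu andbF.
rewrite ge0_integral_setU//;
  [|exact: measurableI|exact: measurableI|exact: mhE|]; last first.
  by move=> x _; rewrite lee_fin.
rewrite left_part right_part.
have m1 : measurable_fun (A `&` I01) (fun u => (h (c * u))%:E).
  exact/measurable_EFinP/measurable_funTS/measurableT_comp.
have m2 : measurable_fun (A `&` I01) (fun u => (h (c + (1 - c) * u))%:E).
  apply/measurable_EFinP/measurable_funTS/measurableT_comp => //.
  by under eq_fun do rewrite addrC; exact: measurable_affine.
rewrite -ge0_integralZl_EFin//; [|by move=> *; rewrite lee_fin|exact: ltW].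
rewrite -ge0_integralZl_EFin//; [|by move=> *; rewrite lee_fin|exact: ltW].
rewrite -ge0_integralD//; last 4 first.
- by move=> x _; rewrite -EFinM lee_fin mulr_ge0// ltW.
- exact: measurable_funeM.
- by move=> x _; rewrite -EFinM lee_fin mulr_ge0// ltW.
- exact: measurable_funeM.
Qed.
End rescale.

(** * Independence and the one-step law *)

Section laws.
Context d (Omega : measurableType d) (R : realType) (P : probability Omega R).
Implicit Types X Y : {RV P >-> R}.

Lemma measurable_RV_preimage X (A : set R) : measurable A ->
  measurable (X @^-1` A).
Proof. by move=> mA; rewrite -[X in measurable X]setTI; exact: measurable_funPT. Qed.

(** The half-lines ]x, +oo[ are stable under intersection and generate the Borel
    sets; their masses are the complements of the given ones. *)
Lemma law_eq_of_cdf_eq X (nu : probability (measurableTypeR R) R) :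
  (forall x, P (X @^-1` `]-oo, x]) = nu `]-oo, x]%classic) ->
  forall A : set R, measurable A -> P (X @^-1` A) = nu A.
Proof.
move=> PX_nu A mA; apply/esym.
have mX : measurable_fun setT (X : Omega -> measurableTypeR R).
  exact: (measurable_funPT X).
apply: (@measure_unique _ R (measurableTypeR R) (@RGenOInfty.G R)
  (fun n => `](- n%:R), +oo[%classic) _ _ _ _ nu
  (pushforward P (X : Omega -> measurableTypeR R))) => //.
- exact: RGenOInfty.measurableE.
- move=> _ _ [x ->] [y ->]; exists (Order.max x y).
  by apply/seteqP; split => u /=; rewrite !in_itv/= !andbT gt_max => /andP.
- by move=> n; exists (- n%:R).
- rewrite -subTset => x _; exists (Num.truncn `|x|).+1 => //=.
  by rewrite in_itv/= andbT ltrNl (le_lt_trans _ (truncnS_gt _))// -normrN ler_norm.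
- move=> _ [x ->].
  have nuC : nu `]x, +oo[%classic = (1 - nu `]-oo, x]%classic)%E.
    by rewrite -setCitvl probability_setC.
  apply: etrans nuC _; rewrite -PX_nu -probability_setC.
    by rewrite preimage_setC setCitvl.
  exact: measurable_RV_preimage.
- by move=> n; exact: (le_lt_trans (probability_le1 nu _) (ltry _)).
Qed.

(** Two finite measures on the plane that agree on rectangles are equal.  The
    event [E] is carried along and contributes only the total mass [k], so that
    this also expresses that (X, Y) is independent of [E]. *)
Lemma product_law X Y (E : set Omega) (rho eta : probability R R)
    (k : {nonneg R}) : measurable E ->
  (forall A B, measurable A -> measurable B ->
    P (X @^-1` A `&` Y @^-1` B `&` E) = (k%:num%:E * (rho A * eta B))%E) ->
  forall S : set (R * R), measurable S ->
    P ((fun w => (X w, Y w)) @^-1` S `&` E) =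
    (k%:num%:E * \int[rho]_x eta (xsection S x))%E.
Proof.
move=> mE prodE S mS.
have mXY : measurable_fun setT (fun w => (X w, Y w)).
  exact: measurable_fun_pair.
transitivity (pushforward (mrestr P mE) (fun w => (X w, Y w)) S) => //.
rewrite -(@product_measure_unique _ _ _ _ R rho (mscale k eta))//; last first.
  move=> A B mA mB; rewrite /= /pushforward/= /mrestr /mscale/=.
  by rewrite muleCA -prodE.
rewrite /product_measure1/= -ge0_integralZl//.
exact: measurable_fun_xsection.
Qed.
End laws.

Section chain_law.
Context d (Omega : measurableType d) (R : realType) (P : probability Omega R).
Variables (c r : nat -> {RV P >-> R}) (rho : probability R R).
Hypothesis c_law : forall n A, measurable A -> P (c n @^-1` A) = rho A.
Hypothesis c_indep : mutually_independent c.
Hypothesis r0_indep : independent_of_family (r 0%N) c.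
Hypothesis r_rec : forall n w, r n.+1 w = rescale (c n w) (r n w).

Let future (J : {fset nat}) (A : nat -> set R) :=
  \bigcap_(i in [set` J]) (c i @^-1` A i).

Let measurable_future J A : (forall i, measurable (A i)) ->
  measurable (future J A).
Proof.
move=> mA; apply: fin_bigcap_measurable => // i _.
exact: measurable_RV_preimage.
Qed.

Let mass_ge0 (J : {fset nat}) (A : nat -> set R) :
  0 <= \prod_(i <- J) fine (rho (A i)).
Proof. by apply: prodr_ge0 => i _; exact: fine_ge0. Qed.

Let mass (J : {fset nat}) (A : nat -> set R) : {nonneg R} := NngNum (mass_ge0 J A).

Let massE (J : {fset nat}) (A : nat -> set R) : (forall i, measurable (A i)) ->
  (\prod_(i <- J) rho (A i) = (mass J A)%:num%:E)%E.
Proof.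
move=> mA; rewrite /mass/= -prodEFin.
by apply: eq_bigr => i _; rewrite fineK// fin_num_measure.
Qed.

(** The future [c_i], [i >= n], enters through finitely many coordinates only;
    [mass J A] is then the probability of the future event. *)
Definition present_indep_of_future n := forall (J : {fset nat})
    (A : nat -> set R) (B : set R),
  (forall i, i \in J -> (n <= i)%N) -> (forall i, measurable (A i)) ->
  measurable B ->
  P (r n @^-1` B `&` future J A) = (P (r n @^-1` B) * (mass J A)%:num%:E)%E.

(** [c_n] is itself part of the future of [r_n]: adding the index [n] to [J]
    gives the mass of a rectangle, and [product_law] extends this to all Borel
    sets of the plane. *)
Let pair_law n (J : {fset nat}) (A : nat -> set R) : present_indep_of_future n ->
  (forall i, i \in J -> (n < i)%N) -> (forall i, measurable (A i)) ->
  forall S : set (R * R), measurable S ->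
    P ((fun w => (c n w, r n w)) @^-1` S `&` future J A) =
    ((mass J A)%:num%:E *
     \int[rho]_x distribution P (r n) (xsection S x))%E.
Proof.
move=> indep_n Jn mA; have nJ : n \notin J by apply/negP => /Jn; rewrite ltnn.
apply: product_law; first exact: measurable_future.
move=> A0 B0 mA0 mB0.
pose A' i := if i == n then A0 else A i.
have mA' i : measurable (A' i) by rewrite /A'; case: ifP.
have -> : c n @^-1` A0 `&` r n @^-1` B0 `&` future J A =
    r n @^-1` B0 `&` future (n |` J)%fset A'.
  rewrite setIAC setIC; congr (_ `&` _); apply/seteqP; split => w.
    move=> [wA0 wJ] i /=; rewrite /A' !inE => /orP[/eqP->|iJ]; first by rewrite eqxx.
    by case: eqP => [iE|_]; [rewrite iE in iJ; rewrite iJ in nJ|exact: wJ].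
  move=> wJ; split.
    by have := wJ n; rewrite /A' eqxx; apply; rewrite /= !inE eqxx.
  move=> i /= iJ; have := wJ i; rewrite /A'; case: eqP => [iE|_].
    by rewrite iE in iJ; rewrite iJ in nJ.
  by apply; rewrite /= !inE iJ orbT.
rewrite indep_n//; last by move=> i; rewrite !inE => /orP[/eqP->//|/Jn/ltnW].
rewrite -!massE// big_fsetU1//= {1}/A' eqxx.
rewrite (eq_big_seq (fun i => rho (A i))) => [|i iJ]; last first.
  by rewrite /A'; case: eqP => // iE; move: nJ; rewrite -iE iJ.
by rewrite muleCA [RHS]muleCA [X in (_ * X)%E]muleC.
Qed.

Let next_preimage n (B : set R) : r n.+1 @^-1` B =
  (fun w => (c n w, r n w)) @^-1` [set p | B (rescale p.1 p.2)].
Proof. by apply/seteqP; split => w /=; rewrite r_rec. Qed.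

Let measurable_next (B : set R) : measurable B ->
  measurable [set p : R * R | B (rescale p.1 p.2)].
Proof.
by move=> mB; rewrite -[X in measurable X]setTI; exact: measurable_rescale.
Qed.

Let next_law n (B : set R) : present_indep_of_future n -> measurable B ->
  P (r n.+1 @^-1` B) = (\int[rho]_x
    distribution P (r n) (xsection [set p | B (rescale p.1 p.2)] x))%E.
Proof.
move=> indep_n mB.
have := @pair_law n fset0 (fun=> setT) indep_n.
move=> /(_ _ _ _ (measurable_next mB)); rewrite -next_preimage.
rewrite -massE// big_seq_fset0 mul1e.
rewrite (_ : future _ _ = setT) ?setIT; first by apply.
by apply/seteqP; split => w // _ i; rewrite /= inE.
Qed.

(** [r_(n+1)] is a function of the pair (c_n, r_n), which is independent of the
    later [c_i] when [r_n] is independent of the [c_i] with [i >= n]. *)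
Lemma present_future_indep n : present_indep_of_future n.
Proof.
elim: n => [|n IHn] J A B Jn mA mB.
  rewrite r0_indep//; last first.
    rewrite /future; apply: (@fin_bigcap_measurable _ (g_sigma_algebraType
      (\bigcup_i preimage_set_system setT (c i) measurable))) => // i _.
    by apply: sub_sigma_algebra; exists i => //; exists (A i) => //; rewrite setTI.
  rewrite c_indep// -massE//; congr (_ * _)%E.
  by apply: eq_bigr => i _; exact: c_law.
rewrite next_law// next_preimage pair_law//; first exact: muleC.
exact: measurable_next.
Qed.

Lemma chain_step n (B : set R) : rho `[0, 1]%classic = 1%E -> measurable B ->
  distribution P (r n.+1) B =
  (\int[rho]_(x in `[0%R, 1%R]) distribution P (r n) (rescale x @^-1` B))%E.
Proof.
move=> rhoI mB; rewrite [LHS]next_law//; last exact: present_future_indep.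
have mI : measurable (~` (`[0, 1]%classic : set R)) by exact: measurableC.
rewrite (ge0_negligible_integral mI)//; last 2 first.
- exact: measurable_fun_xsection (measurable_next mB).
- by rewrite [LHS]probability_setC// rhoI subee.
rewrite setTD setCK; apply: eq_integral => x _; congr (distribution P (r n) _).
by apply/seteqP; split => y; rewrite /xsection/= inE.
Qed.

End chain_law.

(** * The transfer operator on densities *)

Section tonelli_on.
Context d1 d2 (T1 : measurableType d1) (T2 : measurableType d2) (R : realType).
Variables (m1 : {sigma_finite_measure set T1 -> \bar R})
          (m2 : {sigma_finite_measure set T2 -> \bar R}).
Variables (D1 : set T1) (D2 : set T2) (f : T1 * T2 -> \bar R).
Hypotheses (mD1 : measurable D1) (mD2 : measurable D2).
Hypothesis mf : measurable_fun setT f.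
Hypothesis f0 : forall x y, D1 x -> D2 y -> (0 <= f (x, y))%E.

Let g := f \_ (D1 `*` D2).

Let mg : measurable_fun setT g.
Proof.
apply/(measurable_restrictT _ (measurableX mD1 mD2)); exact: measurable_funS mf.
Qed.

Let g0 z : (0 <= g z)%E.
Proof.
rewrite /g patchE; case: ifPn => //; rewrite inE => -[D1z D2z].
by case: z D1z D2z => x y; exact: f0.
Qed.

Let inner2 x : (\int[m2]_y g (x, y) =
  ((fun x => \int[m2]_(y in D2) f (x, y)) \_ D1) x)%E.
Proof.
rewrite [RHS]patchE; case: ifPn => xD1.
  rewrite [RHS]integral_mkcond; apply: eq_integral => y _.
  by rewrite /g !patchE in_setX xD1.
by apply: integral0_eq => y _; rewrite /g patchE in_setX (negPf xD1).
Qed.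

Let inner1 y : (\int[m1]_x g (x, y) =
  ((fun y => \int[m1]_(x in D1) f (x, y)) \_ D2) y)%E.
Proof.
rewrite [RHS]patchE; case: ifPn => yD2.
  rewrite [RHS]integral_mkcond; apply: eq_integral => x _.
  by rewrite /g !patchE in_setX yD2 andbT.
by apply: integral0_eq => x _; rewrite /g patchE in_setX (negPf yD2) andbF.
Qed.

(** Tonelli needs a nonnegative function on the whole product, while
    [split_average] is nonnegative only for [c] in [0, 1]; the extension by zero
    outside D1 x D2 is nonnegative and has the same iterated integrals. *)
Lemma ge0_fubini_tonelli_on :
  (\int[m1]_(x in D1) \int[m2]_(y in D2) f (x, y) =
   \int[m2]_(y in D2) \int[m1]_(x in D1) f (x, y))%E.
Proof.
rewrite integral_mkcond [RHS]integral_mkcond.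
under eq_integral do rewrite -inner2.
under [RHS]eq_integral do rewrite -inner1.
exact: fubini_tonelli.
Qed.

Lemma ge0_measurable_integral_on1 :
  measurable_fun D1 (fun x => \int[m2]_(y in D2) f (x, y))%E.
Proof.
apply/(measurable_restrictT _ mD1); rewrite -(funext inner2).
exact: (measurable_fun_fubini_tonelli_F g).
Qed.

Lemma ge0_measurable_integral_on2 :
  measurable_fun D2 (fun y => \int[m1]_(x in D1) f (x, y))%E.
Proof.
apply/(measurable_restrictT _ mD2); rewrite -(funext inner1).
exact: (measurable_fun_fubini_tonelli_G g).
Qed.

End tonelli_on.

Section transfer_operator.
Context (R : realType) (rho : probability R R).
Notation lam := (@lebesgue_measure R).
Notation I01 := (`[0%R, 1%R]%classic : set R).
Implicit Types h g : R -> R.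

(** The value is an extended real because for an unbounded [h] the integral may
    be infinite on a null set of points [u]. *)
Definition transfer h (u : R) : \bar R :=
  (\int[rho]_(c in I01) (split_average h c u)%:E)%E.

Let kernel h (p : R * R) := (split_average h p.1 p.2)%:E.

Let kernel_ge0 h : (forall x, 0 <= h x) ->
  forall c u, I01 c -> (0 <= kernel h (c, u))%E.
Proof.
move=> h0 c u; rewrite /= in_itv/= => c01.
by rewrite lee_fin split_average_ge0.
Qed.

Let measurable_kernel h : measurable_fun setT h ->
  measurable_fun setT (kernel h).
Proof. by move=> mh; apply/measurable_EFinP; exact: measurable_split_average. Qed.

Lemma transfer_ge0 h u : (forall x, 0 <= h x) -> (0 <= transfer h u)%E.
Proof. by move=> h0; apply: integral_ge0 => c; exact: kernel_ge0. Qed.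

Lemma measurable_transfer h : measurable_fun setT h -> (forall x, 0 <= h x) ->
  measurable_fun setT (transfer h).
Proof.
move=> mh h0.
have mI : measurable I01 by [].
exact: (@ge0_measurable_integral_on2 _ _ _ _ _ rho I01 setT _ mI measurableT
  (measurable_kernel mh) (fun c u cI _ => kernel_ge0 h0 u cI)).
Qed.

(** By Tonelli, [transfer rho h] is the density of the average over [c] of the
    images under [rescale c] of the measure of density [h]. *)
Lemma integral_transfer h (A : set R) : measurable_fun setT h ->
  (forall x, 0 <= h x) -> measurable A ->
  (\int[lam]_(u in A `&` I01) transfer h u =
   \int[rho]_(c in I01) \int[lam]_(x in rescale c @^-1` A `&` I01) (h x)%:E)%E.
Proof.
move=> mh h0 mA.
have mI : measurable I01 by [].
have mAI : measurable (A `&` I01) by exact: measurableI.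
rewrite -(@ge0_fubini_tonelli_on _ _ _ _ _ rho lam _ _ _ mI mAI
  (measurable_kernel mh) (fun c u cI _ => kernel_ge0 h0 u cI)).
apply: eq_integral => c; rewrite inE/= in_itv/= => c01.
by rewrite integral_rescale_preimage.
Qed.

Lemma measurable_integral_rescale h (A : set R) : measurable_fun setT h ->
  (forall x, 0 <= h x) -> measurable A ->
  measurable_fun I01 (fun c =>
    \int[lam]_(x in rescale c @^-1` A `&` I01) (h x)%:E)%E.
Proof.
move=> mh h0 mA.
have mI : measurable I01 by [].
have mAI : measurable (A `&` I01) by exact: measurableI.
apply: (eq_measurable_fun (fun c =>
  \int[lam]_(u in A `&` I01) (split_average h c u)%:E)%E).
  move=> c; rewrite inE/= in_itv/= => c01.
  by rewrite integral_rescale_preimage.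
exact: (@ge0_measurable_integral_on1 _ _ _ _ _ lam _ _ _ mI mAI
  (measurable_kernel mh) (fun c u cI _ => kernel_ge0 h0 u cI)).
Qed.

End transfer_operator.

Section density_step.
Context d (Omega : measurableType d) (R : realType) (P : probability Omega R).
Variable rho : probability R R.
Notation lam := (@lebesgue_measure R).
Notation I01 := (`[0%R, 1%R]%classic : set R).
Implicit Types X Y : {RV P >-> R}.

(** A density is only meaningful on [0, 1]; [g \_ I01] is its extension by zero,
    which is measurable and nonnegative on the whole line. *)
Lemma measurable_pdf X g : is_pdf X g -> measurable_fun setT (g \_ I01).
Proof. by case=> mg _ _; apply/(measurable_restrictT _ (measurable_itv _)). Qed.

Lemma pdf_ge0 X g x : is_pdf X g -> 0 <= (g \_ I01) x.
Proof. by case=> _ g0 _; rewrite patchE; case: ifPn => //; rewrite inE => /g0. Qed.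

Lemma pdf_law X g (A : set R) : is_pdf X g -> measurable A ->
  distribution P X A = (\int[lam]_(x in A `&` I01) ((g \_ I01) x)%:E)%E.
Proof.
case=> _ _ gE mA; rewrite gE//; apply: eq_integral => x.
by rewrite in_setI => /andP[_ xI]; rewrite patchE xI.
Qed.

Lemma pdf_total X g : is_pdf X g -> (\int[lam]_(x in I01) ((g \_ I01) x)%:E = 1)%E.
Proof.
by move=> Xg; rewrite -{1}(setTI I01) -(pdf_law Xg)// probability_setT.
Qed.

(** The transferred density has integral 1, hence is finite almost everywhere,
    and its finite part is a density. *)
Lemma absolutely_continuous_step X Y :
  (forall B, measurable B -> distribution P Y B =
    (\int[rho]_(c in I01) distribution P X (rescale c @^-1` B))%E) ->
  absolutely_continuous_rv X -> absolutely_continuous_rv Y.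
Proof.
move=> Ystep [g Xg]; set h := g \_ I01.
have mh : measurable_fun setT h := measurable_pdf Xg.
have h0 x : 0 <= h x := pdf_ge0 x Xg.
have mG := @measurable_transfer _ rho _ mh h0.
have G0 u := @transfer_ge0 _ rho _ u h0.
have lawY B : measurable B ->
    distribution P Y B = (\int[lam]_(u in B `&` I01) transfer rho h u)%E.
  move=> mB; rewrite integral_transfer// Ystep//.
  apply: eq_integral => c _; rewrite (pdf_law Xg)//.
  exact: measurable_rescale_preimage.
have intG : lam.-integrable I01 (transfer rho h).
  apply/integrableP; split; first exact: measurable_funTS.
  under eq_integral do rewrite gee0_abs//.
  by rewrite -(setTI I01) -lawY// probability_setT ltry.
exists (fine \o transfer rho h); split.
- by apply: measurable_funTS; apply: measurableT_comp => //.
- by move=> u _; exact: fine_ge0.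
- move=> B mB; rewrite lawY//.
  have mBI : measurable (B `&` I01) by exact: measurableI.
  apply: ge0_ae_eq_integral => //.
  + exact: measurable_funTS.
  + apply/measurable_EFinP/measurable_funTS.
    by apply: measurableT_comp => //.
  + by move=> u _; rewrite lee_fin fine_ge0.
  + have := @integrable_ae _ (measurableTypeR R) _ lam I01 (measurable_itv _) _ intG.
    apply: filterS => u ufin [_ uI].
    by rewrite /= fineK// ufin.
Qed.

End density_step.

(** * Lipschitz densities *)

Section lipschitz.
Context (R : realType).
Implicit Types h : R -> R.

Definition lipschitz_by (L : R) h := forall x y, `|h x - h y| <= L * `|x - y|.

Lemma lipschitz_by_ge0 L h : lipschitz_by L h -> 0 <= L.
Proof. by move=> /(_ 1 0); rewrite subr0 normr1 mulr1; exact: le_trans. Qed.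

Lemma lipschitz_by_le L h x y : lipschitz_by L h -> h x <= h y + L * `|x - y|.
Proof. by move=> hL; rewrite -lerBlDl (le_trans (ler_norm _)). Qed.

Lemma measurable_lipschitz L h : lipschitz_by L h -> measurable_fun setT h.
Proof.
move=> hL; apply: continuous_measurable_fun => x.
have L1 : 0 < L + 1 by rewrite ltr_pwDr// (lipschitz_by_ge0 hL).
apply/cvgrPdist_lt => e e0.
have e'0 : 0 < e / (L + 1) by exact: divr_gt0.
apply: filterS (@nbhsx_ballx R R^o x (e / (L + 1)) e'0) => y xy.
rewrite (le_lt_trans (hL x y))//.
rewrite (@le_lt_trans _ _ ((L + 1) * `|x - y|))//.
  by rewrite ler_wpM2r// lerDl.
by rewrite -ltr_pdivlMl// mulrC.
Qed.

End lipschitz.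

Section transfer_lipschitz.
Context (R : realType) (rho : probability R R) (ml : R).
Notation lam := (@lebesgue_measure R).
Notation I01 := (`[0%R, 1%R]%classic : set R).
Hypothesis rhoI : rho I01 = 1%E.
Hypothesis mlE : (\int[rho]_(c in I01) (c ^+ 2 + (1 - c) ^+ 2)%:E = ml%:E)%E.
Implicit Types (h : R -> R) (M L : R).

Definition next_density h u := fine (transfer rho h u).

Variables (h : R -> R) (M L : R).
Hypotheses (h0 : forall x, 0 <= h x) (hM : forall x, h x <= M).
Hypothesis hL : lipschitz_by L h.

Let mh : measurable_fun setT h := measurable_lipschitz hL.

Let mI : measurable I01 := measurable_itv _.

Let measurable_average u : measurable_fun I01 (fun c => (split_average h c u)%:E).
Proof.
apply/measurable_EFinP/measurable_funTS.
exact: (measurableT_comp (measurable_split_average mh) (measurable_pair2 u)).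
Qed.

Let average_ge0 u c : I01 c -> (0 <= (split_average h c u)%:E)%E.
Proof. by rewrite /= in_itv/= => c01; rewrite lee_fin split_average_ge0. Qed.

Lemma transfer_le u : (transfer rho h u <= M%:E)%E.
Proof.
apply: (@le_trans _ _ (\int[rho]_(c in I01) (cst M%:E) c)%E); last first.
  by rewrite integral_cst// [X in (_ * X)%E](_ : _ = 1%E) ?mule1//; exact: rhoI.
apply: ge0_le_integral => //; first exact: average_ge0.
move=> c; rewrite /= in_itv/= => /andP[c0 c1]; rewrite lee_fin.
have -> : M = c * M + (1 - c) * M by ring.
by apply: lerD; apply: ler_wpM2l => //; rewrite subr_ge0.
Qed.

Lemma next_densityE u : (next_density h u)%:E = transfer rho h u.
Proof.
rewrite /next_density fineK// ge0_fin_numE ?transfer_ge0//.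
by rewrite (le_lt_trans (transfer_le u)) ?ltry.
Qed.

Lemma next_density_ge0 u : 0 <= next_density h u.
Proof. exact/fine_ge0/transfer_ge0. Qed.

Lemma next_density_le u : next_density h u <= M.
Proof. by rewrite -lee_fin next_densityE transfer_le. Qed.

(** The two evaluation points move at speed [c] and [1 - c] and the two terms
    carry the same weights, whence the squares. *)
Lemma split_average_lipschitz c u v : 0 <= c <= 1 ->
  split_average h c u <=
  split_average h c v + L * `|u - v| * (c ^+ 2 + (1 - c) ^+ 2).
Proof.
move=> /andP[c0 c1]; have c'0 : 0 <= 1 - c by rewrite subr_ge0.
have hcuv := lipschitz_by_le (c * u) (c * v) hL.
have hc'uv := lipschitz_by_le (c + (1 - c) * u) (c + (1 - c) * v) hL.
rewrite -mulrBr normrM (ger0_norm c0) in hcuv.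
rewrite opprD addrACA subrr add0r -mulrBr normrM (ger0_norm c'0) in hc'uv.
apply: le_trans (lerD (ler_wpM2l c0 hcuv) (ler_wpM2l c'0 hc'uv)) _.
by rewrite le_eqVlt /split_average; apply/orP; left; apply/eqP; ring.
Qed.

Lemma next_density_lipschitz : lipschitz_by (L * ml) (next_density h).
Proof.
have L0 := lipschitz_by_ge0 hL.
have half u v : next_density h u <= next_density h v + L * ml * `|u - v|.
  rewrite mulrAC -lee_fin EFinD EFinM -mlE !next_densityE /transfer.
  have q0 c : (0 <= (c ^+ 2 + (1 - c) ^+ 2)%:E :> \bar R)%E.
    by rewrite lee_fin addr_ge0// sqr_ge0.
  have mq : measurable_fun I01 (fun c : R => (c ^+ 2 + (1 - c) ^+ 2)%:E).
    apply/measurable_EFinP/measurable_funTS.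
    apply: measurable_funD; apply: measurable_funX => //.
    exact: measurable_funB.
  rewrite -ge0_integralZl_EFin//; last exact: mulr_ge0.
  rewrite -ge0_integralD//; last 3 first.
  - exact: average_ge0.
  - by move=> c _; rewrite mule_ge0// lee_fin mulr_ge0.
  - exact: measurable_funeM.
  apply: ge0_le_integral => //.
  - exact: average_ge0.
  - by apply: emeasurable_funD => //; exact: measurable_funeM.
  - move=> c; rewrite /= in_itv/= => c01.
    by rewrite -EFinM -EFinD lee_fin split_average_lipschitz.
move=> u v; rewrite ler_norml; apply/andP; split.
  by rewrite lerNl opprB lerBlDl distrC half.
by rewrite lerBlDl half.
Qed.

End transfer_lipschitz.

(** * Distance between a law and a density *)

Section closeness.
Context (R : realType).
Notation lam := (@lebesgue_measure R).
Notation I01 := (`[0%R, 1%R]%classic : set R).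
Implicit Types (h g : R -> R) (e : R).

(** Total variation distance between [eta] and the measure of density [h], as a
    supremum over Borel sets: an average of laws inherits the bound at once. *)
Definition close_to (eta : set R -> \bar R) h e := forall A, measurable A ->
  (eta A <= \int[lam]_(x in A `&` I01) (h x)%:E + e%:E)%E /\
  (\int[lam]_(x in A `&` I01) (h x)%:E <= eta A + e%:E)%E.

Lemma measurable_law_rescale (eta : probability R R) (A : set R) :
  measurable A -> measurable_fun setT (fun c => eta (rescale c @^-1` A)).
Proof.
move=> mA; pose S := [set p : R * R | A (rescale p.1 p.2)].
have mS : measurable S by rewrite -[S]setTI; exact: measurable_rescale.
have -> : (fun c => eta (rescale c @^-1` A)) = eta \o xsection S.
  by apply/funext => c; congr (eta _); apply/seteqP; split => x;
    rewrite /xsection/= inE.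
exact: measurable_fun_xsection.
Qed.

Lemma le_integral_addr (rho : probability R R) (f1 f2 : R -> \bar R) e :
  rho I01 = 1%E -> 0 <= e ->
  (forall c, I01 c -> 0 <= f1 c)%E -> (forall c, I01 c -> 0 <= f2 c)%E ->
  measurable_fun I01 f1 -> measurable_fun I01 f2 ->
  (forall c, I01 c -> f1 c <= f2 c + e%:E)%E ->
  (\int[rho]_(c in I01) f1 c <= \int[rho]_(c in I01) f2 c + e%:E)%E.
Proof.
move=> rhoI e0 f10 f20 mf1 mf2 f12.
have mI : measurable I01 by [].
have <- : (\int[rho]_(c in I01) cst e%:E c = e%:E)%E.
  by rewrite integral_cst// [X in (_ * X)%E](_ : _ = 1%E) ?mule1//; exact: rhoI.
rewrite -ge0_integralD//.
apply: ge0_le_integral => //; exact: emeasurable_funD.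
Qed.

(** Both measures are averages over [c] of the masses of the sets
    [rescale c @^-1` A], and the bound [e] holds for each of these sets. *)
Lemma close_to_step (rho eta eta' : probability R R) h M L e :
  rho I01 = 1%E -> 0 <= e ->
  (forall x, 0 <= h x) -> (forall x, h x <= M) -> lipschitz_by L h ->
  (forall B, measurable B -> eta' B =
    \int[rho]_(c in I01) eta (rescale c @^-1` B))%E ->
  close_to eta h e -> close_to eta' (next_density rho h) e.
Proof.
move=> rhoI e0 h0 hM hL eta'E eta_h A mA.
have mh := measurable_lipschitz hL.
under eq_integral do rewrite (next_densityE rhoI h0 hM hL).
rewrite integral_transfer// eta'E//.
have mpre c := measurable_rescale_preimage c mA.
have meta : measurable_fun I01 (fun c => eta (rescale c @^-1` A)).
  by apply: measurable_funTS; exact: measurable_law_rescale.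
have mint := measurable_integral_rescale mh h0 mA.
have int_ge0 c :
    (0 <= \int[lam]_(x in rescale c @^-1` A `&` I01) (h x)%:E)%E.
  by apply: integral_ge0 => x _; rewrite lee_fin.
have eta_c c := eta_h _ (mpre c).
by split; apply: le_integral_addr => // c _; have [] := eta_c c.
Qed.

Lemma close_to_of_L1 d (Omega : measurableType d) (P : probability Omega R)
    (X : {RV P >-> R}) g h e : is_pdf X g ->
  measurable_fun setT h -> (forall x, 0 <= h x) ->
  (\int[lam]_(x in I01) `|(g \_ I01) x - h x|%:E <= e%:E)%E ->
  close_to (distribution P X) h e.
Proof.
move=> Xg mh h0 ghe A mA; rewrite (pdf_law Xg)//.
have mg := measurable_pdf Xg; have g0 x := pdf_ge0 x Xg.
have mAI : measurable (A `&` I01) by exact: measurableI.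
have mI : measurable I01 by [].
set f := g \_ I01 in ghe mg g0 *.
have mE (k : R -> R) (D : set R) : measurable_fun setT k ->
    measurable_fun D (fun x => (k x)%:E).
  by move=> mk; apply/measurable_EFinP; exact: measurable_funTS.
have md : measurable_fun setT (fun x => `|f x - h x|).
  by apply: measurableT_comp => //; exact: measurable_funB.
have ghAe : (\int[lam]_(x in A `&` I01) `|f x - h x|%:E <= e%:E)%E.
  by apply: le_trans ghe; apply: ge0_subset_integral => //; exact: mE.
have bound (k1 k2 : R -> R) : measurable_fun setT k1 -> measurable_fun setT k2 ->
    (forall x, 0 <= k1 x) -> (forall x, 0 <= k2 x) ->
    (forall x, k1 x <= k2 x + `|f x - h x|) ->
    (\int[lam]_(x in A `&` I01) (k1 x)%:E <=
     \int[lam]_(x in A `&` I01) (k2 x)%:E + e%:E)%E.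
  move=> mk1 mk2 k10 k20 k12; apply: le_trans (leeD2l _ ghAe).
  rewrite -ge0_integralD//; last 3 first.
  - by move=> x _; rewrite lee_fin.
  - exact: mE.
  - exact: mE.
  apply: ge0_le_integral => //.
  - by move=> x _; rewrite lee_fin.
  - exact: mE.
  - by apply: emeasurable_funD; exact: mE.
  - by move=> x _; rewrite -EFinD lee_fin.
split; apply: bound => // x.
- by rewrite -lerBlDl ler_norm.
- by rewrite -lerBlDl distrC ler_norm.
Qed.

(** The set where [h <= g] and its complement each contribute at most [e]: there
    the L1 distance is a difference of two masses. *)
Lemma L1_of_close_to d (Omega : measurableType d) (P : probability Omega R)
    (X : {RV P >-> R}) g h e : is_pdf X g ->
  measurable_fun setT h -> (forall x, 0 <= h x) ->
  close_to (distribution P X) h e ->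
  (\int[lam]_(x in I01) `|(g \_ I01) x - h x|%:E <= (e + e)%:E)%E.
Proof.
move=> Xg mh h0 gh.
have mg := measurable_pdf Xg; have g0 x := pdf_ge0 x Xg.
have mI : measurable I01 by [].
have lawE A (mA : measurable A) := pdf_law Xg mA.
have gT := pdf_total Xg.
set f := g \_ I01 in lawE gT mg g0 *.
have mE (k : R -> R) (D : set R) : measurable_fun setT k ->
    measurable_fun D (fun x => (k x)%:E).
  by move=> mk; apply/measurable_EFinP; exact: measurable_funTS.
pose A := [set x | h x <= f x].
have mA : measurable A.
  by rewrite -[A]setTI; apply: measurable_fun_ler.
have mAI : measurable (A `&` I01) by exact: measurableI.
have mA'I : measurable (~` A `&` I01) by exact: measurableI (measurableC _) _.
(* on a set where k2 <= k1 the L1 distance is a difference of masses *)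
have part (k1 k2 : R -> R) (D : set R) : measurable D -> D `<=` I01 ->
    measurable_fun setT k1 -> measurable_fun setT k2 ->
    (forall x, 0 <= k2 x) -> (forall x, D x -> k2 x <= k1 x) ->
    (\int[lam]_(x in I01) (k2 x)%:E < +oo)%E ->
    (\int[lam]_(x in D) (k1 x)%:E <= \int[lam]_(x in D) (k2 x)%:E + e%:E)%E ->
    (\int[lam]_(x in D) `|k1 x - k2 x|%:E <= e%:E)%E.
  move=> mD DI mk1 mk2 k20 k21 k2oo k1k2.
  have fin2 : (\int[lam]_(x in D) (k2 x)%:E)%E \is a fin_num.
    rewrite ge0_fin_numE; last by apply: integral_ge0 => x _; rewrite lee_fin.
    apply: le_lt_trans k2oo; apply: ge0_subset_integral => //; first exact: mE.
    by move=> x _; rewrite lee_fin.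
  rewrite -(leeD2lE _ _ fin2); apply: le_trans k1k2.
  rewrite -ge0_integralD//; last 3 first.
  - by move=> x _; rewrite lee_fin.
  - exact: mE.
  - by apply: mE; apply: measurableT_comp => //; exact: measurable_funB.
  rewrite le_eqVlt; apply/orP; left; apply/eqP; apply: eq_integral => x.
  by rewrite inE => /k21 k21x; rewrite ger0_norm ?subr_ge0// -EFinD addrC subrK.
have hoo : (\int[lam]_(x in I01) (h x)%:E < +oo)%E.
  have [_] := gh _ measurableT; rewrite setTI => /le_lt_trans; apply.
  by rewrite probability_setT -EFinD ltry.
have -> : I01 = (A `&` I01) `|` (~` A `&` I01) by rewrite -setIUl setUv setTI.
have md : measurable_fun setT (fun x => `|f x - h x|).
  by apply: measurableT_comp => //; exact: measurable_funB.
rewrite ge0_integral_setU//; last 2 first.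
- exact: mE.
- by apply/disj_setPLR => x [Ax _] [].
rewrite EFinD; apply: leeD.
- apply: (part f h _ mAI) => //; first by move=> x [].
  by rewrite -lawE//; have [] := gh _ mA.
- under eq_integral do rewrite distrC.
  apply: (part h f _ mA'I) => //.
  + by move=> x [/negP + _]; rewrite -ltNge => /ltW.
  + by rewrite gT ltry.
  + by rewrite -lawE; [have [] := gh _ (measurableC mA)|exact: measurableC].
Qed.

(** On an interval of length 1 a Lipschitz function stays within [L] of its
    mean, and the mean is within [e] of 1. *)
Lemma lipschitz_mean_dist h L e :
  (forall x, 0 <= h x) -> lipschitz_by L h ->
  (1 <= \int[lam]_(x in I01) (h x)%:E + e%:E)%E ->
  (\int[lam]_(x in I01) (h x)%:E <= 1 + e%:E)%E ->
  forall u, I01 u -> `|h u - 1| <= L + e.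
Proof.
move=> h0 hL h_ge h_le u uI.
have mh := measurable_lipschitz hL.
have L0 := lipschitz_by_ge0 hL.
have mI : measurable I01 by [].
have lamI : lam I01 = 1%E.
  by rewrite lebesgue_measure_itv/= lte_fin ltr01 sube0.
have hosc x : I01 x -> `|h u - h x| <= L.
  move: uI; rewrite /= !in_itv/= => /andP[u0 u1] /andP[x0 x1].
  rewrite (le_trans (hL u x))// ler_piMr// ler_norml; apply/andP; split; lra.
have cstE k : (\int[lam]_(x in I01) cst k%:E x = k%:E)%E.
  by rewrite integral_cst// [X in (_ * X)%E](_ : _ = 1%E) ?mule1//; exact: lamI.
have mhE : measurable_fun I01 (fun x => (h x)%:E).
  by apply/measurable_EFinP; exact: measurable_funTS.
rewrite ler_norml; apply/andP; split.
- have : (\int[lam]_(x in I01) (h x)%:E <= (h u + L)%:E)%E.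
    rewrite -cstE; apply: ge0_le_integral => // x xI.
      by rewrite lee_fin.
    rewrite lee_fin -lerBlDl; have := hosc x xI.
    by rewrite distrC; apply: le_trans; exact: ler_norm.
  move=> hu; have := le_trans h_ge (leeD2r _ hu).
  by rewrite -EFinD lee_fin => ?; lra.
- have : ((h u)%:E <= \int[lam]_(x in I01) (h x)%:E + L%:E)%E.
    rewrite -(cstE L) -ge0_integralD//; last first.
      by move=> x _; rewrite lee_fin.
    rewrite -cstE; apply: ge0_le_integral => //.
    - by move=> x _; rewrite lee_fin.
    - exact: emeasurable_funD.
    - move=> x xI; rewrite /= -EFinD lee_fin -lerBlDl.
      by apply: le_trans (hosc x xI); exact: ler_norm.
  move=> hu; have := le_trans hu (leeD2r _ h_le).
  by rewrite -!EFinD lee_fin => ?; lra.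
Qed.
End closeness.

(** * Lipschitz approximation in L1 *)

Section sliding_mean.
Context (R : realType).
Notation lam := (@lebesgue_measure R).
Notation I01 := (`[0%R, 1%R]%classic : set R).
Variables (f : R -> R) (M : R).
Hypotheses (mf : measurable_fun setT f) (f0 : forall x, 0 <= f x).
Hypotheses (fM : forall x, f x <= M) (f_out : forall x, ~ I01 x -> f x = 0).

Let M0 : 0 <= M. Proof. exact: le_trans (f0 0) (fM 0). Qed.

Let intf : lam.-integrable setT (EFin \o f).
Proof.
have mI : measurable I01 by [].
have -> : EFin \o f = (EFin \o f) \_ I01.
  apply/funext => x; rewrite patchE; case: ifPn => //.
  by rewrite notin_setE /= => /f_out ->.
apply: (@integrable_mkcond _ (measurableTypeR R) R lam I01 _ _).1 => //.
apply: measurable_bounded_integrable => //.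
- by rewrite /= lebesgue_measure_itv/= lte_fin ltr01 -EFinB ltry.
- exact: measurable_funTS.
- exists M; split; first exact: num_real.
  by move=> N MN x _ /=; rewrite ger0_norm// (le_trans (fM x))// ltW.
Qed.

Let intS (D : set R) : measurable D -> lam.-integrable D (EFin \o f).
Proof. by move=> mD; exact: integrableS intf. Qed.

Let F x : R := (\int[lam]_(t in `]-oo, x]) f t)%R.

Let F_increment x y : x <= y -> 0 <= F y - F x <= M * (y - x).
Proof.
move=> xy; rewrite /F Rintegral_itvB ?bnd_simp//; last exact: intS.
have mD : measurable (`]x, y]%classic : set R) by [].
have lamD : lam `]x, y]%classic = (y - x)%:E.
  rewrite lebesgue_measure_itv/= lte_fin; case: ifPn => [_|]; first by rewrite EFinB.
  by rewrite -leNgt => yx; rewrite (@le_anti _ _ y x) ?subrr// xy yx.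
rewrite Rintegral_ge0//=.
have -> : M * (y - x) = \int[lam]_(t in `]x, y]) cst M t.
  by rewrite Rintegral_cst//; congr (_ * _); rewrite -[LHS]/(fine (y - x)%:E) -lamD.
apply: le_Rintegral => //; first exact: intS.
apply: measurable_bounded_integrable => //.
- by apply: (@le_lt_trans _ _ (lam `]x, y]%classic)) => //; rewrite lamD ltry.
- exists M; split; first exact: num_real.
  by move=> N MN t _ /=; rewrite ger0_norm// ltW.
Qed.

(** The mean of [f] over [x, x + 1 / (k + 1)].  It inherits the bounds of [f],
    is Lipschitz because [f] is bounded, and is a difference quotient of the
    primitive [F]. *)
Definition sliding_mean k x := k.+1%:R * (F (k.+1%:R^-1 + x) - F x).

Let F_lipschitz : lipschitz_by M F.
Proof.
move=> x y; wlog xy : x y / y <= x.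
  move=> H; case: (leP y x) => [/H//|/ltW/H].
  by rewrite distrC [X in _ <= _ * X]distrC.
by rewrite !ger0_norm ?subr_ge0//; have /andP[] := F_increment xy; rewrite ?subr_ge0.
Qed.

Lemma sliding_mean_ge0 k x : 0 <= sliding_mean k x.
Proof.
have xk : x <= k.+1%:R^-1 + x by rewrite lerDr.
by rewrite mulr_ge0//; have /andP[] := F_increment xk.
Qed.

Lemma sliding_mean_le k x : sliding_mean k x <= M.
Proof.
have xk : x <= k.+1%:R^-1 + x by rewrite lerDr.
have /andP[_] := F_increment xk; rewrite addrK => FM.
by rewrite /sliding_mean mulrC -ler_pdivlMr.
Qed.

Lemma sliding_mean_lipschitz k : lipschitz_by (k.+1%:R * (M + M)) (sliding_mean k).
Proof.
move=> x y; rewrite /sliding_mean -mulrBr normrM ger0_norm// -mulrA ler_wpM2l//.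
have -> : F (k.+1%:R^-1 + x) - F x - (F (k.+1%:R^-1 + y) - F y) =
    F (k.+1%:R^-1 + x) - F (k.+1%:R^-1 + y) + (F y - F x) by ring.
rewrite mulrDl.
apply: le_trans (ler_normD _ _) _; apply: lerD.
  by apply: le_trans (F_lipschitz _ _) _; rewrite opprD addrACA subrr add0r.
by rewrite [X in _ <= _ * X]distrC; exact: F_lipschitz.
Qed.

(** Lebesgue differentiation: [F] has derivative [f x] at almost every [x]. *)
Lemma sliding_mean_cvg :
  {ae lam, forall x, (sliding_mean k x)%:E @[k --> \oo] --> (f x)%:E}.
Proof.
have locf : locally_integrable setT f.
  by apply: open_integrable_locally => //; exact: openT.
have := FTC1Ny (fun y => intS (measurable_itv _)) locf.
apply: filterS; first exact: (ae_filter_ringOfSetsType lam).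
move=> x [dF Fx]; apply/fine_cvgP; split; first exact: nearW.
have /cvg_ex[l Fl] := dF.
have lE : l = f x.
  rewrite -Fx derive1E; apply/esym/cvg_lim => //.
move/cvgr_dnbhsP : Fl => /(_ (@harmonic R)) Fl; rewrite -lE.
have step : (forall n, harmonic n != 0 :> R) /\ harmonic @ \oo --> (0 : R).
  by split=> [n|]; [rewrite gt_eqF ?harmonic_gt0|exact: cvg_harmonic].
move: (Fl step); apply: cvg_trans; apply: near_eq_cvg; apply: nearW => k.
by rewrite /= /sliding_mean /harmonic invrK /GRing.scale/= mulr1.
Qed.

Lemma sliding_mean_L1 :
  (\int[lam]_(x in I01) `|f x - sliding_mean k x|%:E @[k --> \oo] --> 0)%E.
Proof.
have mh k : measurable_fun setT (sliding_mean k).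
  exact: measurable_lipschitz (sliding_mean_lipschitz k).
have [||||| _ + _] := @dominated_convergence _ (measurableTypeR R) R lam I01
  (measurable_itv _) (fun k => EFin \o sliding_mean k) (EFin \o f) (cst M%:E).
- by move=> k; apply/measurable_EFinP; exact: measurable_funTS (mh k).
- by apply/measurable_EFinP; exact: measurable_funTS mf.
- have := sliding_mean_cvg.
  by apply: filterS => [|x + _]; first exact: (ae_filter_ringOfSetsType lam).
- apply: measurable_bounded_integrable => //.
  + by rewrite /= lebesgue_measure_itv/= lte_fin ltr01 -EFinB ltry.
  + exists M; split; first exact: num_real.
    by move=> N MN t _ /=; rewrite ger0_norm// ltW.
- apply: nearW => x k _ /=.
  by rewrite lee_fin ger0_norm ?sliding_mean_ge0 ?sliding_mean_le.
apply: cvg_trans; apply: near_eq_cvg; apply: nearW => k /=.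
by apply: eq_integral => x _; rewrite distrC.
Qed.

End sliding_mean.

Section lipschitz_approximation.
Context (R : realType).
Notation lam := (@lebesgue_measure R).
Notation I01 := (`[0%R, 1%R]%classic : set R).

Lemma truncation_L1 (g : R -> R) : measurable_fun setT g ->
  (forall x, 0 <= g x) -> (\int[lam]_(x in I01) (g x)%:E < +oo)%E ->
  (\int[lam]_(x in I01) `|g x - Num.min (g x) m%:R|%:E @[m --> \oo] --> 0)%E.
Proof.
move=> mg g0 goo.
have mt (m : nat) : measurable_fun setT (fun x => Num.min (g x) m%:R).
  exact: measurable_minr.
have [||||| _ + _] := @dominated_convergence _ (measurableTypeR R) R lam I01
  (measurable_itv _) (fun m => EFin \o (fun x => Num.min (g x) m%:R))
  (EFin \o g) (EFin \o g).
- by move=> k; apply/measurable_EFinP; exact: measurable_funTS (mt k).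
- by apply/measurable_EFinP; exact: measurable_funTS mg.
- apply: nearW => x _; apply: cvg_near_cst.
  exists (Num.truncn (g x)).+1 => // m /= xm; congr EFin; apply/min_idPl.
  by rewrite ltW// (lt_le_trans (truncnS_gt _))// ler_nat.
- apply/integrableP; split.
    by apply/measurable_EFinP; exact: measurable_funTS.
  by under eq_integral do rewrite /= ger0_norm//.
- apply: nearW => x m _ /=; rewrite lee_fin ger0_norm ?ge_min ?lexx//.
  by rewrite le_min g0 ler0n.
apply: cvg_trans; apply: near_eq_cvg; apply: nearW => k /=.
by apply: eq_integral => x _; rewrite distrC.
Qed.

(** Truncation at a high level makes the function bounded, and the sliding means
    of the truncated function are Lipschitz; each step costs [e / 2]. *)
Lemma lipschitz_approximation (g : R -> R) e : measurable_fun setT g ->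
  (forall x, 0 <= g x) -> (forall x, ~ I01 x -> g x = 0) ->
  (\int[lam]_(x in I01) (g x)%:E < +oo)%E -> 0 < e ->
  exists h M L, [/\ forall x, 0 <= h x, forall x, h x <= M, lipschitz_by L h &
    (\int[lam]_(x in I01) `|g x - h x|%:E <= e%:E)%E].
Proof.
move=> mg g0 g_out goo e0.
have e2 : (0 < (e / 2)%:E)%E by rewrite lte_fin divr_gt0.
have [m _ /(_ _ (leqnn m)) /= gm] :=
  truncation_L1 mg g0 goo (open_ereal_lt' e2).
pose f x := Num.min (g x) m%:R.
have f0 x : 0 <= f x by rewrite le_min g0 ler0n.
have fM x : f x <= m%:R by rewrite ge_min lexx orbT.
have f_out x : ~ I01 x -> f x = 0.
  by move=> /g_out; rewrite /f => ->; apply/min_idPl.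
have mf : measurable_fun setT f by exact: measurable_minr.
have [k _ /(_ _ (leqnn k)) /= fk] :=
  sliding_mean_L1 mf f0 fM f_out (open_ereal_lt' e2).
have hL := sliding_mean_lipschitz mf f0 fM f_out k.
exists (sliding_mean f k), m%:R, (k.+1%:R * (m%:R + m%:R)); split => //.
- exact: sliding_mean_ge0 mf f0 fM f_out k.
- exact: sliding_mean_le mf f0 fM f_out k.
have mh := measurable_lipschitz hL.
have mI : measurable I01 by [].
have md (u v : R -> R) : measurable_fun setT u -> measurable_fun setT v ->
    measurable_fun I01 (fun x => `|u x - v x|%:E).
  move=> mu mv; apply/measurable_EFinP/measurable_funTS.
  by apply: measurableT_comp => //; exact: measurable_funB.
rewrite [in leRHS](splitr e) EFinD.
apply: le_trans (leeD (ltW gm) (ltW fk)).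
rewrite -ge0_integralD//; [|exact: md|exact: md].
apply: ge0_le_integral => //; [exact: md|by apply: emeasurable_funD; exact: md|].
by move=> x _; rewrite -EFinD lee_fin (le_trans _ (ler_normD _ _))// addrA subrK.
Qed.
End lipschitz_approximation.

(** * The contraction factor *)

Section moments.
Context d (Omega : measurableType d) (R : realType) (P : probability Omega R).
Notation I01 := (`[0%R, 1%R]%classic : set R).
Variable X : {RV P >-> R}.
Hypothesis XI : distribution P X I01 = 1%E.

Let mXI : measurable (X @^-1` I01).
Proof. exact: measurable_RV_preimage. Qed.

Let PXI : P (~` (X @^-1` I01)) = 0%E.
Proof. by rewrite probability_setC// [X in (_ - X)%E]XI subee. Qed.

Let int_on (k : R -> R) N : measurable_fun setT k ->
  (forall x, 0 <= x <= 1 -> `|k x| <= N) ->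
  P.-integrable (X @^-1` I01) (EFin \o (k \o X)).
Proof.
move=> mk kN; apply: measurable_bounded_integrable => //.
- by rewrite (le_lt_trans (probability_le1 _ _))// ltry.
- by apply: measurable_funTS; exact: measurableT_comp.
- exists N; split; first exact: num_real.
  by move=> N' NN' w /=; rewrite in_itv/= => /kN /le_trans; apply; exact: ltW.
Qed.

(** The variable is in [0, 1] only almost surely, so that boundedness of [k] on
    [0, 1] bounds [k \o X] only off a null event. *)
Lemma integrable_bounded_on_unit (k : R -> R) N : measurable_fun setT k ->
  (forall x, 0 <= x <= 1 -> `|k x| <= N) ->
  P.-integrable setT (EFin \o (k \o X)).
Proof.
move=> mk kN; apply/(@negligible_integrable _ _ _ P setT (~` (X @^-1` I01))) => //.
- exact: measurableC.
- by apply/measurable_EFinP; exact: measurableT_comp.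
- by rewrite setTD setCK; exact: int_on kN.
Qed.

Lemma integral_law_on_unit (k : R -> R) N : measurable_fun setT k ->
  (forall x, 0 <= x <= 1 -> `|k x| <= N) ->
  (\int[distribution P X]_(x in I01) (k x)%:E = \int[P]_w (k (X w))%:E)%E.
Proof.
move=> mk kN.
rewrite (@negligible_integral _ _ _ P setT (~` (X @^-1` I01)))//; last 2 first.
- exact: measurableC.
- exact: integrable_bounded_on_unit kN.
rewrite setTD setCK.
apply: (@integral_pushforward _ _ _ _ R X _ P I01 (EFin \o k)) => //.
- by apply/measurable_EFinP.
- exact: int_on kN.
Qed.

(** Expanding around the mean,
    x^2 + (1 - x)^2 = 2 (x - mu)^2 + (4 mu - 2) x + 1 - 2 mu^2;
    this involves only the two moments that are given. *)
Lemma split_second_moment mu sigma :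
  ('E_P[X] = mu%:E)%E -> ('V_P[X] = (sigma ^+ 2)%:E)%E ->
  (\int[distribution P X]_(c in I01) (c ^+ 2 + (1 - c) ^+ 2)%:E =
   (1 - 2 * (mu - mu ^+ 2 - sigma ^+ 2))%:E)%E.
Proof.
move=> EX VX.
have mid : measurable_fun setT (fun x : R => x) by [].
have mdev : measurable_fun setT (fun x : R => (x - mu) ^+ 2).
  by apply: measurable_funX; exact: measurable_funB.
have mq : measurable_fun setT (fun x : R => x ^+ 2 + (1 - x) ^+ 2).
  by apply: measurable_funD; apply: measurable_funX => //; exact: measurable_funB.
have id_bd (x : R) : 0 <= x <= 1 -> `|x| <= 1.
  by move=> /andP[x0 x1]; rewrite ger0_norm.
have dev_bd (x : R) : 0 <= x <= 1 -> `|(x - mu) ^+ 2| <= (1 + `|mu|) ^+ 2.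
  move=> x01; rewrite normrX lerXn2r ?nnegrE ?addr_ge0//.
  by rewrite (le_trans (ler_normB _ _))// lerD2r id_bd.
have q_bd (x : R) : 0 <= x <= 1 -> `|x ^+ 2 + (1 - x) ^+ 2| <= 2.
  move=> /andP[x0 x1]; rewrite ger0_norm ?addr_ge0 ?sqr_ge0//.
  by nra.
rewrite (integral_law_on_unit mq q_bd).
have intX := integrable_bounded_on_unit mid id_bd.
have intdev := integrable_bounded_on_unit mdev dev_bd.
have E1 : (\int[P]_w (X w)%:E = mu%:E)%E by rewrite -EX unlock.
have E2 : (\int[P]_w ((X w - mu) ^+ 2)%:E = (sigma ^+ 2)%:E)%E.
  rewrite -VX /variance !unlock -/(expectation _ _).
  apply: eq_integral => w _; rewrite E1 /=.
  by rewrite expr2.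
transitivity (\int[P]_w (2%:E * ((X w - mu) ^+ 2)%:E +
    ((4 * mu - 2)%:E * (X w)%:E + (1 - 2 * mu ^+ 2)%:E)))%E.
  apply: eq_integral => w _; rewrite -!EFinM -!EFinD; congr EFin.
  by ring.
rewrite integralD//; last 2 first.
- exact: integrableZl.
- apply: integrableD => //; first exact: integrableZl.
  exact: finite_measure_integrable_cst.
rewrite integralD//; last 2 first.
- exact: integrableZl.
- exact: finite_measure_integrable_cst.
have E3 (k : R) : (\int[P]_w cst k%:E w = k%:E)%E.
  by rewrite integral_cst// [X in (_ * X)%E](_ : _ = 1%E) ?mule1//;
    exact: probability_setT.
rewrite !integralZl// E1 E2 E3.
by rewrite -!EFinM -!EFinD; congr EFin; ring.
Qed.

Lemma split_second_moment_ge0 ml :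
  (\int[distribution P X]_(c in I01) (c ^+ 2 + (1 - c) ^+ 2)%:E = ml%:E)%E ->
  0 <= ml.
Proof.
by rewrite -lee_fin => <-; apply: integral_ge0 => x _; rewrite lee_fin addr_ge0// sqr_ge0.
Qed.

(** [c ^ 2 + (1 - c) ^ 2 = 1 - 2 c (1 - c)], and the nonnegative function
    [c (1 - c)] would vanish almost surely if its mean were 0. *)
Lemma split_second_moment_lt1 ml :
  (\int[distribution P X]_(c in I01) (c ^+ 2 + (1 - c) ^+ 2)%:E = ml%:E)%E ->
  (0 < P [set w | (0 < X w < 1)%R])%E -> ml < 1.
Proof.
move=> mlE nondeg.
have mI : measurable I01 by [].
have mq : measurable_fun I01 (fun c : R => (c ^+ 2 + (1 - c) ^+ 2)%:E).
  apply/measurable_EFinP/measurable_funTS.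
  by apply: measurable_funD; apply: measurable_funX => //; exact: measurable_funB.
have mp : measurable_fun I01 (fun c : R => (2 * (c * (1 - c)))%:E).
  apply/measurable_EFinP/measurable_funTS.
  by apply: measurable_funM => //; apply: measurable_funM => //; exact: measurable_funB.
have p0 c : I01 c -> (0 <= (2 * (c * (1 - c)))%:E :> \bar R)%E.
  by rewrite /= in_itv/= => /andP[c0 c1]; rewrite lee_fin !mulr_ge0// subr_ge0.
have sum1 : (ml%:E + \int[distribution P X]_(c in I01) (2 * (c * (1 - c)))%:E = 1)%E.
  rewrite -mlE -ge0_integralD//; last first.
    by move=> c _; rewrite lee_fin addr_ge0// sqr_ge0.
  rewrite (eq_integral (cst 1%E)); last first.
    by move=> c _; rewrite -EFinD; congr EFin; ring.
  by rewrite integral_cst// mul1e; exact: XI.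
rewrite ltNge; apply/negP => ml1.
have p_le0 : (\int[distribution P X]_(c in I01) (2 * (c * (1 - c)))%:E <= 0)%E.
  have fml : ml%:E \is a fin_num by [].
  by rewrite -(leeD2lE _ _ fml) sum1 adde0 lee_fin.
have p_eq0 : (\int[distribution P X]_(c in I01) `|(2 * (c * (1 - c)))%:E| = 0)%E.
  under eq_integral => c do (move=> /set_mem/p0 cp; rewrite gee0_abs//).
  by apply/eqP; rewrite eq_le integral_ge0// andbT; exact: p_le0.
have [N [mN N0 subN]] := (ae_eq_integral_abs _ mI mp).1 p_eq0.
suff : (P [set w | (0 < X w < 1)%R] <= 0)%E by rewrite leNgt nondeg.
rewrite -N0; apply: le_measure; rewrite ?inE.
- rewrite (_ : [set w | _] = X @^-1` `]0, 1[); first exact: measurable_RV_preimage.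
  by apply/seteqP; split => w /=; rewrite in_itv.
- exact: measurable_RV_preimage.
move=> w /= /andP[X0 X1]; apply: subN => /=.
rewrite in_itv/= (ltW X0) (ltW X1) => /(_ isT) [].
by apply/eqP; rewrite !mulf_neq0// ?gt_eqF// subr_gt0.
Qed.
End moments.

(** * Convergence to the uniform density *)

Section L1_bound.
Context d (Omega : measurableType d) (R : realType) (P : probability Omega R).
Notation lam := (@lebesgue_measure R).
Notation I01 := (`[0%R, 1%R]%classic : set R).

(** The distance from [g] to [h] is at most [2 e], and [h] is within [L + e] of
    1 on [0, 1]. *)
Lemma L1norm_pdf_sub1 (X : {RV P >-> R}) g h L e : is_pdf X g ->
  (forall x, 0 <= h x) -> lipschitz_by L h ->
  close_to (distribution P X) h e ->
  (L1norm (fun u => g u - 1)%R <= (3 * e + L)%:E)%E.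
Proof.
move=> Xg h0 hL gh.
have mh := measurable_lipschitz hL.
have mg := measurable_pdf Xg.
have mI : measurable I01 by [].
have gh_L1 := L1_of_close_to Xg mh h0 gh.
have h1 u : I01 u -> `|h u - 1| <= L + e.
  have [h_ge h_le] := gh _ measurableT; rewrite setTI in h_ge h_le.
  apply: lipschitz_mean_dist => //.
    by apply: le_trans h_ge; rewrite [leRHS]probability_setT.
  by apply: le_trans h_le _; rewrite probability_setT.
have h1_L1 : (\int[lam]_(u in I01) `|h u - 1|%:E <= (L + e)%:E)%E.
  apply: (@le_trans _ _ (\int[lam]_(u in I01) cst (L + e)%:E u)%E).
    apply: ge0_le_integral => //.
    apply/measurable_EFinP/measurable_funTS.
    by apply: measurableT_comp => //; exact: measurable_funB.
  rewrite integral_cst// [X in (_ * X)%E](_ : _ = 1%E) ?mule1//.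
  by rewrite /= lebesgue_measure_itv/= lte_fin ltr01 sube0.
have -> : 3 * e + L = (e + e) + (L + e) by ring.
rewrite EFinD; apply: le_trans (leeD gh_L1 h1_L1).
have md (u v : R -> R) : measurable_fun setT u -> measurable_fun setT v ->
    measurable_fun I01 (fun x => `|u x - v x|%:E).
  move=> mu mv; apply/measurable_EFinP/measurable_funTS.
  by apply: measurableT_comp => //; exact: measurable_funB.
rewrite -ge0_integralD//; [|exact: md|exact: md].
have -> : L1norm (fun u => g u - 1)%R =
    (\int[lam]_(u in I01) `|((g \_ I01) u - cst 1 u)%R|%:E)%E.
  by apply: eq_integral => u uI; rewrite patchE uI.
apply: ge0_le_integral => //; [exact: md|by apply: emeasurable_funD; exact: md|].
by move=> x _; rewrite -EFinD lee_fin (le_trans _ (ler_normD _ _))// addrA subrK.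
Qed.

End L1_bound.

Lemma cvge0_of_geometric_bound (R : realType) (u : nat -> \bar R) (q : R) :
  0 <= q < 1 -> (forall n, 0 <= u n)%E ->
  (forall eps, 0 < eps -> exists C, forall n, (u n <= (eps + C * q ^+ n)%:E)%E) ->
  u @ \oo --> 0%E.
Proof.
move=> /andP[q0 q1] u0 ub.
have ufin n : u n \is a fin_num.
  have [C uC] := ub 1 ltr01.
  by rewrite ge0_fin_numE// (le_lt_trans (uC n)) ?ltry.
apply/fine_cvgP; split; first exact: nearW.
apply/cvgrPdist_le => e e0.
have e2 : 0 < e / 2 by rewrite divr_gt0.
have [C uC] := ub (e / 2) e2.
have : C * q ^+ n @[n --> \oo] --> C * 0.
  by apply: cvgMr; apply: cvg_expr; rewrite ger0_norm.
rewrite mulr0 => /cvgrPdist_le /(_ (e / 2) e2).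
apply: filterS => n; rewrite !sub0r !normrN => Cq.
rewrite /= ger0_norm ?fine_ge0//.
have := uC n; rewrite -(fineK (ufin n)) lee_fin => /le_trans; apply.
by rewrite [leRHS]splitr lerD2l (le_trans (ler_norm _)).
Qed.

Theorem theorem10 (R : realType) (d : measure_display)
    (Omega : measurableType d) (P : probability Omega R)
    (F : R -> R) (c r : nat -> {RV P >-> R}) (mu sigma : R)
    (F_cdf : cdf_on_unit F)
    (c_law : forall n x, cdf (c n) x = (F x)%:E)
    (c_indep : mutually_independent c)
    (c_mean : ('E_P[c 0%N] = mu%:E)%E)
    (c_var : ('V_P[c 0%N] = (sigma ^+ 2)%:E)%E)
    (r0_unit : {ae P, forall w, 0 <= r 0%N w <= 1})
    (r0_ac : absolutely_continuous_rv (r 0%N))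
    (r0_indep : independent_of_family (r 0%N) c)
    (r_rec : forall n w, r n.+1 w = rescale (c n w) (r n w))
    (c_nondeg : (0 < P [set w | (0 < c 0%N w < 1)%R])%E) :
  (forall n, absolutely_continuous_rv (r n)) /\
  forall g : nat -> R -> R, (forall n, is_pdf (r n) (g n)) ->
    L1norm (fun u => g n u - 1) @[n --> \oo] --> 0%E /\
    forall eps : R, 0 < eps -> exists C : R, forall n,
      (L1norm (fun u => g n u - 1)%R <=
        (eps + C * (1 - 2 * (mu - mu ^+ 2 - sigma ^+ 2)) ^+ n)%:E)%E.
Proof.
pose rho : probability R R := distribution P (c 0%N).
have [nu nuI nuF] := F_cdf.
have law_nu n A : measurable A -> P (c n @^-1` A) = nu A.
  by apply: law_eq_of_cdf_eq => x; rewrite nuF; exact: c_law.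
have law_eq n A : measurable A -> P (c n @^-1` A) = rho A.
  by move=> mA; rewrite law_nu// [RHS]law_nu.
have rhoI : rho `[0, 1]%classic = 1%E by rewrite [LHS]law_nu.
have step n B := @chain_step _ _ _ _ _ _ _ law_eq c_indep r0_indep r_rec n B rhoI.
have mlE := split_second_moment rhoI c_mean c_var.
set ml := 1 - _ in mlE *.
have ml01 : 0 <= ml < 1.
  rewrite (split_second_moment_ge0 mlE)/=.
  exact: (@split_second_moment_lt1 _ _ _ P (c 0%N) rhoI ml mlE c_nondeg).
split.
  by elim=> // n; apply: absolutely_continuous_step; exact: step.
move=> g g_pdf.
have bound eps : 0 < eps -> exists C : R, forall n,
    (L1norm (fun u => g n u - 1)%R <= (eps + C * ml ^+ n)%:E)%E.
  move=> eps0; have e0 : 0 < eps / 3 by rewrite divr_gt0.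
  have g0_pdf := g_pdf 0%N.
  have g0_out x : ~ (`[0, 1]%classic : set R) x -> (g 0%N \_ `[0, 1]) x = 0.
    by move=> xI; rewrite patchE memNset.
  have g0_fin : (\int[lebesgue_measure]_(x in `[0%R, 1%R])
      ((g 0%N \_ `[0, 1]) x)%:E < +oo)%E.
    by rewrite (pdf_total g0_pdf) ltry.
  have [h [M [L [h0 hM hL gh]]]] := lipschitz_approximation
    (measurable_pdf g0_pdf) (fun x => pdf_ge0 x g0_pdf) g0_out g0_fin e0.
  exists L => n.
  (* the iterates of [h] stay [eps / 3]-close to the law of [r n], while their
     Lipschitz constants decrease geometrically *)
  pose h_ n := iter n (next_density rho) h.
  have [h_0 h_M h_L g_h] : [/\ forall x, 0 <= h_ n x, forall x, h_ n x <= M,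
      lipschitz_by (L * ml ^+ n) (h_ n) &
      close_to (distribution P (r n)) (h_ n) (eps / 3)].
    elim: n => [|n [IH0 IHM IHL IHg]].
      split=> //; first by rewrite expr0 mulr1.
      exact: close_to_of_L1 g0_pdf (measurable_lipschitz hL) h0 gh.
    rewrite (_ : h_ n.+1 = next_density rho (h_ n))//; split.
    - exact: next_density_ge0 IH0.
    - exact: (@next_density_le R rho rhoI _ _ _ IH0 IHM IHL).
    - rewrite exprSr mulrA.
      exact: (@next_density_lipschitz R rho _ rhoI mlE _ _ _ IH0 IHM IHL).
    - exact: (@close_to_step R rho (distribution P (r n)) (distribution P (r n.+1))
        _ _ _ _ rhoI (ltW e0) IH0 IHM IHL (step n) IHg).
  have -> : eps = 3 * (eps / 3) by field.
  exact: L1norm_pdf_sub1 (g_pdf n) h_0 h_L g_h.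
split; last exact: bound.
apply: cvge0_of_geometric_bound ml01 _ bound.
by move=> n; apply: integral_ge0.
Qed.
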